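(* Let $F$ be any (non-empty) subset of a metric space. For any $0<\theta_1 < \theta_2 < 1$ we have \[ \dim_\mathrm{A}^{\theta_1} F \ \leq \ \left(\frac{1-\theta_2}{1-\theta_1} \right) \dim_\mathrm{A}^{\theta_2} F \, + \, \left( \frac{\theta_2-\theta_1}{1-\theta_1} \right) \dim_\mathrm{A}^{\theta_1/\theta_2} F. \] In particular, by setting $\theta_2=\sqrt{\theta_1}$, we have \[ \dim_\mathrm{A}^{\theta_1}F \ \leq \ \dim_\mathrm{A}^{\sqrt{\theta_1}}F \] for any $\theta_1\in (0,1)$. Furthermore, for any $\theta\in(0,1)$ we can find $\theta'\in(0,1)$ arbitrarily close to $1$ such that $\dim_\mathrm{A}^{\theta'}F\geq \dim_\mathrm{A}^{\theta}F$.
   Context: For a subset $E$ of a metric space and $r>0$, $N(E,r)$ denotes the minimal number of balls of radius $r$ required to cover $E$, and $B(x,R)$ is the ball of radius $R$ centred at $x$. For $\theta\in(0,1)$, the Assouad spectrum of $F$ at $\theta$ is \[ \dim_{\mathrm A}^{\theta} F = \inf\Big\{\alpha : \exists C>0,\ \exists \rho>0,\ \forall\, 0<R\leq\rho,\ \forall x\in F,\ N(B(x,R)\cap F,R^{1/\theta})\leq C \big(R/R^{1/\theta}\big)^{\alpha}\Big\}. \]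
   Formalization: The balls counted by N(B(x,R)∩F, r) are required to be centred in F (F with its induced metric); with centres anywhere in the ambient metric space the inequality can fail for non-doubling sets, while for doubling sets the dimensions are the same. *)

(* Defs.v *)
From HB Require Import structures.
From mathcomp Require Import all_boot all_order all_algebra.
From mathcomp Require Import all_classical all_reals all_analysis.

Set Implicit Arguments.
Unset Strict Implicit.
Unset Printing Implicit Defensive.

Import Order.TTheory GRing.Theory Num.Theory.
Import numFieldNormedType.Exports.

Local Open Scope classical_set_scope.
Local Open Scope ring_scope.

(* Minimal number of balls of radius r of the metric (sub)space Y needed to
   cover E; it is +oo when no finite cover exists. *)
Definition covering_number (R : realType) (T : metricType R) (Y E : set T)
    (r : R) : \bar R :=
  ereal_inf [set (n%:R)%:E | n in [set n : nat | exists c : 'I_n -> T,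
    (forall i, Y (c i)) /\ E `<=` [set y | exists i, ball (c i) r y]]].

(* F carries the induced metric, so the covering balls are centred in F.
   In a doubling space this gives the same value as centres anywhere in T.
   In an arbitrary metric space centres outside F can change the value, and
   the inequality dim^theta F <= dim^(sqrt theta) F then fails: let F consist
   of the leaves of nested stars whose hubs lie outside F. *)
Definition assouad_spectrum (R : realType) (T : metricType R) (theta : R)
    (F : set T) : \bar R :=
  ereal_inf [set alpha%:E | alpha in [set alpha : R |
    exists2 C : R, 0 < C & exists2 rho : R, 0 < rho &
    forall r : R, 0 < r <= rho -> forall x : T, F x ->
      (covering_number F (ball x r `&` F) (r `^ theta^-1)
        <= (C * (r / r `^ theta^-1) `^ alpha)%:E)%E]].

(* Main.v *)
Require Import Defs.
From HB Require Import structures.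
From mathcomp Require Import all_boot all_order all_algebra.
From mathcomp Require Import all_classical all_reals all_analysis.
From mathcomp Require Import ring lra.

Import Order.TTheory GRing.Theory Num.Theory.
Import numFieldNormedType.Exports.

Local Open Scope classical_set_scope.
Local Open Scope ring_scope.

(** Write [p = theta2 / theta1], so that [p > 1], and pass from the scale [r] to
    the much smaller scale [r^(1/theta1)] in two steps, through the intermediate
    scale [s = r^p].  Since [theta1 / theta2 = 1/p], the spectrum at
    [theta1 / theta2] bounds the number of [s]-balls that cover a ball of radius
    [r]; since [s^(1/theta2) = r^(1/theta1)], the spectrum at [theta2] bounds the
    number of [r^(1/theta1)]-balls that cover each of these [s]-balls.  The
    numbers multiply, so exponents [beta] and [alpha] for the two steps give the
    bound [(r/s)^beta * (s/r^(1/theta1))^alpha] up to a constant, and the share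
    of each step in [log (r / r^(1/theta1))] is the weight of the
    corresponding exponent: [1 - p = (1 - 1/theta1) * (theta2 - theta1) /
    (1 - theta1)] for [beta], and the complementary weight for [alpha].  This is
    [spectrum_exponent_interpolation].

    To pass to the infimum over [alpha] and [beta], the two dimensions should not
    be [-oo].  They are nonnegative ([spectrum_exponent_ge0]): a negative exponent
    would make the allowed number of balls tend to 0 with [r], but a nonempty set
    needs at least one ball.

    For [theta2 = sqrt theta1] the two dimensions on the right coincide, and the
    weights add up to 1.  Iterated square roots of a number in (0, 1) tend to 1
    from below, and the spectrum does not decrease along them; this gives the
    parameters arbitrarily close to 1. *)

(** * Covering numbers *)

(** Covers indexed by any finite type, so that nested covers can be indexed by
    dependent pairs. *)
Lemma covering_number_le_card {R : realType} {T : metricType R} (F E : set T)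
    (r : R) (I : finType) (c : I -> T) :
  (forall i, F (c i)) -> E `<=` [set y | exists i, ball (c i) r y] ->
  (covering_number F E r <= (#|I|%:R)%:E)%E.
Proof.
move=> Fc Ec; apply: ereal_inf_lbound; exists #|I| => //.
exists (c \o enum_val); split=> [i|y /Ec[i ciy]]; first exact: Fc.
by exists (enum_rank i); rewrite /= enum_rankK.
Qed.

Lemma covering_number_lt {R : realType} {T : metricType R} {F E : set T}
    {r M : R} :
  (covering_number F E r < M%:E)%E ->
  exists n : nat, n%:R < M /\ exists c : 'I_n -> T,
    (forall i, F (c i)) /\ E `<=` [set y | exists i, ball (c i) r y].
Proof.
move=> /ereal_inf_lt[_ [n nE <-]]; rewrite lte_fin => nM.
by exists n.
Qed.

Lemma covering_number_ge1 {R : realType} {T : metricType R} (F E : set T)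
    (r : R) : E !=set0 -> (1%:E <= covering_number F E r)%E.
Proof.
move=> [x Ex]; apply: le_ereal_inf_tmp => _ [n [c [_ Ec]] <-].
have [i _] := Ec _ Ex.
by rewrite lee_fin ler1n (leq_ltn_trans (leq0n i)).
Qed.

(** Cover [E] by [s]-balls, and cover each of these by [t]-balls.  The [s]-balls
    must be centred in [F] for the second step to apply to them.  The strict
    bounds provide actual covers without any appeal to the infimum being
    attained. *)
Lemma covering_number_refine {R : realType} {T : metricType R} (F E : set T)
    (s t M N : R) :
  0 <= N -> E `<=` F -> (covering_number F E s < M%:E)%E ->
  (forall x, F x -> (covering_number F (ball x s `&` F) t < N%:E)%E) ->
  (covering_number F E t <= (M * N)%:E)%E.
Proof.
move=> N0 EF /covering_number_lt[m [mM [c [Fc Ec]]]] FN.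
have /choice[n nP] i := covering_number_lt (FN (c i) (Fc i)).
have d_ i := cid (nP i).2.
pose d (u : {i : 'I_m & 'I_(n i)}) := sval (d_ (tag u)) (tagged u).
have dF u : F (d u) by rewrite /d; case: (d_ _) => ? [].
have dE : E `<=` [set y | exists u, ball (d u) t y].
  move=> y Ey; have [i ciy] := Ec _ Ey.
  have [j dj] : exists j, ball (sval (d_ i) j) t y.
    by case: (d_ i) => ? [_] /=; apply; split=> //; apply: EF.
  by exists (Tagged (fun i => 'I_(n i)) j).
apply: le_trans (covering_number_le_card F E t _ d dF dE) _.
rewrite lee_fin card_tagged sumnE big_map big_enum /= natr_sum.
apply: (@le_trans _ _ (\sum_(i < m) N)).
  by apply: ler_sum => i _; rewrite card_ord ltW // (nP i).1.
by rewrite sumr_const card_ord -mulr_natl ler_wpM2r // ltW.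
Qed.

(** * Exponents admissible for the Assouad spectrum *)

(** The set of exponents whose infimum is [assouad_spectrum theta F]. *)
Definition spectrum_exponent {R : realType} {T : metricType R} (theta : R)
    (F : set T) (alpha : R) : Prop :=
  exists2 C : R, 0 < C & exists2 rho : R, 0 < rho &
    forall r : R, 0 < r <= rho -> forall x : T, F x ->
      (covering_number F (ball x r `&` F) (r `^ theta^-1)
        <= (C * (r / r `^ theta^-1) `^ alpha)%:E)%E.

Lemma ratio_powR {R : realType} (r p : R) : 0 < r -> r / r `^ p = r `^ (1 - p).
Proof. by move=> r0; rewrite powRB ?(lt0r_neq0 r0) ?implybT// powRr1 ?ltW. Qed.

(** As [1 - 1/theta < 0], a negative [alpha] turns the bound on the covering
    number into [C * r^p] with [p > 0], which drops below 1 for small [r]. *)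
Lemma spectrum_exponent_ge0 {R : realType} {T : metricType R} (F : set T)
    (theta alpha : R) :
  F !=set0 -> 0 < theta < 1 -> spectrum_exponent theta F alpha -> 0 <= alpha.
Proof.
move=> [x Fx] /andP[t0 t1] [C C0 [rho rho0 Fcov]].
rewrite leNgt; apply/negP => alpha0.
pose p := (1 - theta^-1) * alpha.
have p0 : 0 < p by rewrite nmulr_rgt0// subr_lt0 invf_gt1.
(* This [r] satisfies C * r^p <= 1/2. *)
pose r := Num.min rho ((2 * C)^-1 `^ p^-1).
have r0 : 0 < r by rewrite lt_min rho0 powR_gt0// invr_gt0 mulr_gt0.
have := Fcov r; rewrite r0 ge_min lexx => /(_ isT x Fx).
move=> /(le_trans (covering_number_ge1 _ _ _ _)).
rewrite lee_fin ratio_powR// -powRrM -/p => h.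
have : 1 <= C * r `^ p by apply: h; exists x; split=> //; exact: ballxx.
apply/negP; rewrite -ltNge.
have : r `^ p <= (2 * C)^-1.
  rewrite (_ : (2 * C)^-1 = ((2 * C)^-1 `^ p^-1) `^ p); last first.
    by rewrite -powRrM mulVf ?lt0r_neq0// powRr1// invr_ge0 mulr_ge0// ltW.
  rewrite ge0_ler_powR ?nnegrE ?powR_ge0 ?(ltW p0) ?(ltW r0)//.
  by rewrite ge_min lexx orbT.
move=> /(ler_wpM2l (ltW C0))/le_lt_trans; apply.
by rewrite invfM mulrCA mulfV ?gt_eqF// mulr1; lra.
Qed.

(** The two-step cover through the scale [s = r^(theta2/theta1)].  The scale
    [r^(1/theta2)] would also connect the same two spectra, but it puts the
    different weight [(theta2 - theta1) / (theta2 * (1 - theta1))] on [beta]. *)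
Lemma spectrum_exponent_interpolation {R : realType} {T : metricType R}
    (F : set T) (theta1 theta2 alpha beta : R) :
  0 < theta1 -> theta1 < theta2 -> theta2 < 1 ->
  spectrum_exponent theta2 F alpha ->
  spectrum_exponent (theta1 / theta2) F beta ->
  spectrum_exponent theta1 F
    ((1 - theta2) / (1 - theta1) * alpha
     + (theta2 - theta1) / (1 - theta1) * beta).
Proof.
move=> t10 t12 t21 [C C0 [rho rho0 Fa]] [D D0 [sigma sigma0 Fb]].
have t20 := lt_trans t10 t12.
(* The factors 2 make the bounds on the two covering numbers strict. *)
exists ((2 * D) * (2 * C)); first by rewrite !mulr_gt0.
(* For r <= 1 also s <= r, so a single bound on r serves both scales. *)
exists (Num.min sigma (Num.min rho 1)); first by rewrite !lt_min sigma0 rho0/=.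
move=> r; rewrite !le_min => /and4P[r0 rsigma rrho r1] x Fx.
pose s := r `^ (theta1 / theta2)^-1.
have s0 : 0 < s by rewrite powR_gt0.
have srho : s <= rho.
  apply: le_trans rrho; apply: ge1r_powR; first by rewrite r0.
  by rewrite invf_div ler_pdivlMr// mul1r ltW.
have st : s `^ theta2^-1 = r `^ theta1^-1.
  by rewrite -powRrM; congr (_ `^ _); field; rewrite !gt_eqF.
have double (A B : R) : 0 < A -> 0 < B -> A * B < 2 * A * B.
  by move=> A0 B0; rewrite -mulrA ltr_pMl ?mulr_gt0// ltr1n.
have ratio0 u p q : 0 < u -> 0 < (u / u `^ p) `^ q :> R.
  by move=> u0; rewrite powR_gt0// divr_gt0// powR_gt0.
apply: (@le_trans _ _ ((2 * D * (r / s) `^ beta)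
    * (2 * C * (s / r `^ theta1^-1) `^ alpha))%:E).
  apply: (@covering_number_refine _ _ _ _ s) => [||| y Fy].
  - by rewrite !mulr_ge0 ?powR_ge0 ?ltW.
  - exact: subIsetr.
  - apply: le_lt_trans (Fb r _ x Fx) _; first by rewrite r0.
    by rewrite lte_fin double// ratio0.
  - rewrite -st; apply: le_lt_trans (Fa s _ y Fy) _; first by rewrite s0.
    by rewrite lte_fin double// ratio0.
rewrite lee_fin [leLHS]mulrACA; apply: ler_wpM2l.
  by rewrite !mulr_ge0 ?ltW.
rewrite -[in leLHS]st !ratio_powR// -!powRrM -powRD ?(lt0r_neq0 r0) ?implybT//.
suff -> : (1 - (theta1 / theta2)^-1) * beta
    + (theta1 / theta2)^-1 * ((1 - theta2^-1) * alpha)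
  = (1 - theta1^-1) * ((1 - theta2) / (1 - theta1) * alpha
      + (theta2 - theta1) / (1 - theta1) * beta).
  by [].
by field; rewrite !gt_eqF// subr_gt0 (lt_trans t12).
Qed.

(** * The interpolation inequality *)

Lemma assouad_spectrum_le {R : realType} {T : metricType R} (F : set T)
    (theta alpha : R) :
  spectrum_exponent theta F alpha -> (assouad_spectrum theta F <= alpha%:E)%E.
Proof. by move=> a_exp; apply: ereal_inf_lbound; exists alpha. Qed.

Lemma assouad_spectrum_ge0 {R : realType} {T : metricType R} (F : set T)
    (theta : R) :
  F !=set0 -> 0 < theta < 1 -> (0 <= assouad_spectrum theta F)%E.
Proof.
move=> F0 t01; apply: le_ereal_inf_tmp => _ [alpha a_exp <-].
by rewrite lee_fin; apply: spectrum_exponent_ge0 a_exp.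
Qed.

Lemma assouad_spectrum_approx {R : realType} {T : metricType R} (F : set T)
    (theta d e : R) :
  assouad_spectrum theta F = d%:E -> 0 < e ->
  exists2 alpha, spectrum_exponent theta F alpha & alpha < d + e.
Proof.
move=> dim_d e0.
have : (assouad_spectrum theta F < (d + e)%:E)%E.
  by rewrite dim_d lte_fin ltrDl.
by move=> /ereal_inf_lt[_ [alpha a_exp <-]]; exists alpha.
Qed.

Lemma assouad_spectrum_interpolation {R : realType} {T : metricType R}
    (F : set T) (theta1 theta2 : R) :
  F !=set0 -> 0 < theta1 -> theta1 < theta2 -> theta2 < 1 ->
  (assouad_spectrum theta1 F <=
     ((1 - theta2) / (1 - theta1))%:E * assouad_spectrum theta2 F
     + ((theta2 - theta1) / (1 - theta1))%:E
       * assouad_spectrum (theta1 / theta2) F)%E.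
Proof.
move=> F0 t10 t12 t21.
have t20 := lt_trans t10 t12; have t11 := lt_trans t12 t21.
set a := _ / _; set b := (_ - theta1) / _.
have a0 : 0 < a by rewrite divr_gt0 ?subr_gt0.
have b0 : 0 < b by rewrite divr_gt0 ?subr_gt0.
have ab1 : a + b = 1 by rewrite /a /b; field; rewrite gt_eqF// subr_gt0.
have A0 : (0 <= assouad_spectrum theta2 F)%E.
  by apply: assouad_spectrum_ge0; rewrite ?t20.
have B0 : (0 <= assouad_spectrum (theta1 / theta2) F)%E.
  by apply: assouad_spectrum_ge0; rewrite // divr_gt0//= ltr_pdivrMr// mul1r.
(* An infinite dimension makes the right-hand side infinite, because the
   other term is not [-oo]. *)
case EA: (assouad_spectrum theta2 F) A0 => [x| |] // A0; last first.
  rewrite gt0_muley ?lte_fin// addye ?leey// gt_eqF//.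
  by rewrite (lt_le_trans (ltNyr 0))// mule_ge0// lee_fin ltW.
case EB: (assouad_spectrum (theta1 / theta2) F) B0 => [y| |] // B0; last first.
  by rewrite gt0_muley ?lte_fin// addey ?leey.
(* As [a + b = 1], an error [e] in both exponents gives an error [e] in all. *)
apply/lee_addgt0Pr => e e0.
have [alpha a_exp ale] := assouad_spectrum_approx _ _ _ _ EA e0.
have [beta b_exp ble] := assouad_spectrum_approx _ _ _ _ EB e0.
have := spectrum_exponent_interpolation _ _ _ _ _ t10 t12 t21 a_exp b_exp.
move=> /assouad_spectrum_le/le_trans; apply.
rewrite -!EFinM -!EFinD lee_fin -/a -/b.
rewrite -[e in leRHS]mul1r -ab1 mulrDl addrACA -!mulrDr.
by rewrite lerD// ler_wpM2l ?(ltW a0) ?(ltW b0) ?ltW.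
Qed.

(** * Square roots and parameters close to 1 *)

Lemma assouad_spectrum_sqrt {R : realType} {T : metricType R} (F : set T)
    (theta : R) :
  F !=set0 -> 0 < theta < 1 ->
  (assouad_spectrum theta F <= assouad_spectrum (Num.sqrt theta) F)%E.
Proof.
move=> F0 /andP[t0 t1]; set q := Num.sqrt theta.
have q0 : 0 < q by rewrite sqrtr_gt0.
have q2 : theta = q * q by rewrite -expr2 sqr_sqrtr ?ltW.
have q1 : q < 1 by rewrite -sqrtr1 ltr_sqrt.
have tq : theta < q by rewrite q2 gtr_pMl.
have := assouad_spectrum_interpolation F theta q F0 t0 tq q1.
rewrite (_ : theta / q = q); last by rewrite q2 mulfK ?gt_eqF.
move=> /le_trans; apply.
have weight0 (u v : R) : u < v -> (0 <= ((v - u) / (1 - theta))%:E)%E.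
  by move=> uv; rewrite lee_fin divr_ge0 ?subr_ge0 ?(ltW uv) ?(ltW t1).
rewrite -ge0_muleDl ?weight0// -EFinD -mulrDl addrA subrK divff ?mul1e//.
by rewrite gt_eqF// subr_gt0.
Qed.

(** The quantity [1/x - 1] measures the distance to 1 and at least halves when the
    square root is taken: with [u = 1 / sqrt x], the difference of the two sides
    is [(u - 1)^2]. *)
Lemma sqrt_inv_sub1 {R : realType} (x : R) :
  0 < x < 1 -> 2 * ((Num.sqrt x)^-1 - 1) <= x^-1 - 1.
Proof.
move=> /andP[x0 x1].
have -> : x^-1 = (Num.sqrt x)^-1 ^+ 2 by rewrite exprVn sqr_sqrtr// ltW.
by rewrite -subr_ge0 (_ : _ - _ = ((Num.sqrt x)^-1 - 1) ^+ 2) ?sqr_ge0//; ring.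
Qed.

(** The parameter is the [n]-fold square root of [theta]; phrasing the hypothesis
    through [1/theta - 1] lets each square root use up one factor 2. *)
Lemma assouad_spectrum_near1 {R : realType} {T : metricType R} (F : set T)
    (e : R) (n : nat) (theta : R) :
  F !=set0 -> 0 < theta < 1 -> theta^-1 - 1 < e * 2 ^+ n ->
  exists theta' : R, [/\ 0 < theta' < 1, 1 - e < theta'
    & (assouad_spectrum theta F <= assouad_spectrum theta' F)%E].
Proof.
move=> F0; elim: n theta => [|n IHn] theta t01 small.
  exists theta; split=> //; case/andP: t01 => t0 t1.
  have : 1 - theta <= theta^-1 - 1.
    rewrite -subr_ge0 (_ : _ - _ = (1 - theta) ^+ 2 / theta).
      by rewrite divr_ge0 ?sqr_ge0 ?ltW.
    by field; rewrite gt_eqF.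
  by move: small; rewrite expr0; lra.
have s01 : 0 < Num.sqrt theta < 1.
  case/andP: t01 => t0 t1.
  by rewrite sqrtr_gt0 t0 -[ltRHS]sqrtr1 ltr_sqrt.
have [|theta' [t'01 near le']] := IHn _ s01.
  by have := sqrt_inv_sub1 _ t01; move: small; rewrite exprS; lra.
exists theta'; split; [exact: t'01|exact: near|].
exact: le_trans (assouad_spectrum_sqrt _ _ F0 t01) le'.
Qed.

Theorem proposition3p7 (R : realType) (T : metricType R) (F : set T)
    (F0 : F !=set0) :
  [/\ forall theta1 theta2 : R, 0 < theta1 -> theta1 < theta2 -> theta2 < 1 ->
        (assouad_spectrum theta1 F <=
           ((1 - theta2) / (1 - theta1))%:E * assouad_spectrum theta2 F
           + ((theta2 - theta1) / (1 - theta1))%:E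
             * assouad_spectrum (theta1 / theta2) F)%E,
      forall theta1 : R, 0 < theta1 < 1 ->
        (assouad_spectrum theta1 F <=
           assouad_spectrum (Num.sqrt theta1) F)%E
    & forall theta : R, 0 < theta < 1 -> forall e : R, 0 < e ->
        exists theta' : R, [/\ 0 < theta' < 1, 1 - e < theta'
          & (assouad_spectrum theta F <= assouad_spectrum theta' F)%E]].
Proof.
split=> [theta1 theta2|theta1|theta t01 e e0].
- exact: assouad_spectrum_interpolation.
- exact: assouad_spectrum_sqrt.
- pose n := Num.bound ((theta^-1 - 1) / e).
  apply: (assouad_spectrum_near1 F e n theta F0 t01).
  have t0 : 0 <= (theta^-1 - 1) / e.
    case/andP: t01 => t0 t1.
    by rewrite divr_ge0 ?(ltW e0)// subr_ge0 invf_ge1// ltW.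
  rewrite mulrC -ltr_pdivrMr//; apply: lt_trans (archi_boundP t0) _.
  by rewrite -natrX ltr_nat ltn_expl.
Qed.
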